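(* Let $d\ge 1$, $R>0$, $\Omega=(-R,R)^d$, and write points of $\mathbb{R}^d$ as ${\bf x}=(x_1,\dots,x_{d-1},z)$. Let $\Gamma^+=\{{\bf x}=(x_1,\dots,x_{d-1},R): |x_i|\le R,\ 1\le i\le d-1\}\subset\partial\Omega$. Let $\beta>1$, $r>R+1$ and $b>R+r$. Then there exist a number $\lambda_0=\lambda_0(\beta,r,R,b,d)$ and a constant $C=C(r,R,b,d)>0$, depending only on the listed parameters, such that for all $\lambda>\lambda_0$ and all $u\in C^2(\overline\Omega)$ with $u=0$ on $\partial\Omega$ and $u_z=0$ on $\Gamma^+$, \[ \int_\Omega e^{2\lambda (\frac{z+r}{b})^\beta}|\Delta u|^2\,d{\bf x}\ \ge\ C\lambda^3\beta^2(\beta-1)b^{-3\beta}(-R+r)^{2\beta}\int_\Omega e^{2\lambda(\frac{z+r}{b})^\beta}|u|^2\,d{\bf x}+C\lambda(\beta-1)b^{-\beta}\int_\Omega e^{2\lambda(\frac{z+r}{b})^\beta}|\nabla u|^2\,d{\bf x}. \]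
   Context: $u_z$ denotes the partial derivative of $u$ with respect to the last coordinate $z$. *)

(* Defs.v *)
From HB Require Import structures.
From mathcomp Require Import all_boot all_order all_algebra.
From mathcomp Require Import all_classical all_reals all_analysis.
Set Implicit Arguments. Unset Strict Implicit. Unset Printing Implicit Defensive.
Import Order.TTheory GRing.Theory Num.Theory.
Import numFieldNormedType.Exports.
Local Open Scope classical_set_scope.
Local Open Scope ring_scope.

Section Carleman.
Context {R : realType} {d : nat}.

Definition unitv (i : 'I_d) : 'rV[R]_d := delta_mx 0 i.

Definition partial (i : 'I_d) (f : 'rV[R]_d -> R) (x : 'rV[R]_d) : R :=
  'D_(unitv i) f x.

Definition box_open (a : R) : set 'rV[R]_d :=
  [set x | forall i, - a < x 0 i < a].
Definition box_closed (a : R) : set 'rV[R]_d :=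
  [set x | forall i, - a <= x 0 i <= a].
Definition box_boundary (a : R) : set 'rV[R]_d :=
  box_closed a `\` box_open a.

Definition cont_ext (a : R) (f g : 'rV[R]_d -> R) : Prop :=
  {within box_closed a, continuous g} /\ (forall x, box_open a x -> g x = f x).

Definition C2_closure (a : R) (u : 'rV[R]_d -> R) : Prop :=
  [/\ {within box_closed a, continuous u},
      (forall x, box_open a x -> forall i j,
          derivable u x (unitv i) /\ derivable (partial i u) x (unitv j)),
      (forall i, exists g, cont_ext a (partial i u) g) &
      (forall i j, exists g, cont_ext a (partial j (partial i u)) g)].

Definition laplacian (u : 'rV[R]_d -> R) (x : 'rV[R]_d) : R :=
  \sum_(i < d) partial i (partial i u) x.

Definition grad_norm2 (u : 'rV[R]_d -> R) (x : 'rV[R]_d) : R :=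
  \sum_(i < d) (partial i u x) ^+ 2.

Definition setcoord (x : 'rV[R]_d) (k : nat) (t : R) : 'rV[R]_d :=
  \row_j (if nat_of_ord j == k then t else x 0 j).

Fixpoint iter_int (a : R) (f : 'rV[R]_d -> R) (k : nat) (x : 'rV[R]_d) : R :=
  match k with
  | 0 => f x
  | k'.+1 => \int[lebesgue_measure]_(t in `](- a), a[) iter_int a f k' (setcoord x k' t)
  end.

Definition cube_int (a : R) (f : 'rV[R]_d -> R) : R := iter_int a f d 0.

End Carleman.

Section Top.
Context {R : realType} {n : nat}.
Definition zcoord (x : 'rV[R]_n.+1) : R := x 0 ord_max.

Definition Gamma_plus (a : R) : set 'rV[R]_n.+1 :=
  [set x | zcoord x = a /\ forall i : 'I_n.+1, i != ord_max -> - a <= x 0 i <= a].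

Definition dz_zero_on_top (a : R) (u : 'rV[R]_n.+1 -> R) : Prop :=
  exists g, cont_ext a (partial ord_max u) g /\ (forall x, Gamma_plus a x -> g x = 0).

Definition cweight (lam beta r b : R) (x : 'rV[R]_n.+1) : R :=
  expR (2 * lam * ((zcoord x + r) / b) `^ beta).
End Top.

(* Main.v *)
Require Import Defs.
From HB Require Import structures.
From mathcomp Require Import all_boot all_order all_algebra.
From mathcomp Require Import all_classical all_reals all_analysis.
From mathcomp Require Import ring lra.
Set Implicit Arguments. Unset Strict Implicit. Unset Printing Implicit Defensive.
Import Order.TTheory GRing.Theory Num.Theory.
Import numFieldNormedType.Exports.
Local Open Scope classical_set_scope.
Local Open Scope ring_scope.

(* Write s = lam ((z + r) / b)^beta and w = e^s u. The conjugated operator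
   e^s (Laplacian u) splits as P1 + P2 with P2 = - 2 s' w_z - 2 s'' w, and
   (P1 + P2)^2 >= 2 P1 P2. Integrating by parts, the boundary terms vanish, except
   the one on the bottom face, which has the good sign, and 2 P1 P2 becomes
     2 (3 s'' w_z^2 + s'' |grad' w|^2 + (s'^2 s'' + s' s''' - s''^2 - s'''') w^2),
   grad' being the gradient in the first n variables. The cubic term s'^2 s''
   dominates the other zeroth-order terms as soon as lam is large. *)

(** * Iterated integrals of continuous functions on the box *)

(** The term [- 2 s'' w] in P2 makes the tangential gradient positive: in 2 P1 P2, pairing
    [- 2 s' w_z] with the Laplacian of w leaves [- 2 s'' |grad' w|^2], and [- 2 s'' w] contributes
    [4 s'' |grad' w|^2]. Returning from w to u costs a share of the cubic term, because
    [u_z = exp (- s) w_z - s' u]. Nothing is integrated by parts term by term. The difference of the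
    two integrands is written pointwise as nonnegative terms plus exact derivatives of fluxes built
    from u and its first derivatives, so no third derivative of u arises. Each flux is
    differentiated in one variable and only the sign of the integral of its derivative matters,
    which suits integrals taken in a fixed order of the coordinates. *)

Lemma continuous_integrable_oo {R : realType} (h : R -> R) (a b : R) :
  {within `[a, b], continuous h} ->
  (@lebesgue_measure R).-integrable `]a, b[ (EFin \o h).
Proof.
move=> ch.
have := continuous_compact_integrable (@segment_compact R a b) ch.
by apply: integrableS => //; exact: subset_itv_oo_cc.
Qed.

Section Box.
Context {R : realType} {d : nat} (a : R).
Implicit Types (x y : 'rV[R]_d) (i j : 'I_d) (f g F G : 'rV[R]_d -> R).

Lemma setcoordE x i t j :
  setcoord x i t 0 j = if j == i then t else x 0 j.
Proof. by rewrite mxE (inj_eq val_inj). Qed.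

Lemma setcoord_same x i t : setcoord x i t 0 i = t.
Proof. by rewrite setcoordE eqxx. Qed.

Lemma setcoord_id x i : setcoord x i (x 0 i) = x.
Proof. by apply/rowP => j; rewrite setcoordE; case: eqP => // ->. Qed.

Lemma setcoordK x i s t : setcoord (setcoord x i s) i t = setcoord x i t.
Proof. by apply/rowP => j; rewrite !setcoordE; case: eqP. Qed.

Lemma setcoordC x i j s t : i != j ->
  setcoord (setcoord x i s) j t = setcoord (setcoord x j t) i s.
Proof.
move=> ij; apply/rowP => l; rewrite !setcoordE.
by have [->|//] := eqVneq l j; rewrite eq_sym (negbTE ij).
Qed.

Lemma setcoord_open x (i : nat) t : box_open a x -> - a < t < a ->
  box_open a (setcoord x i t).
Proof. by move=> bx ta j; rewrite mxE; case: eqP. Qed.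

Lemma setcoord_closed x (i : nat) t : box_closed a x -> - a <= t <= a ->
  box_closed a (setcoord x i t).
Proof. by move=> bx ta j; rewrite mxE; case: eqP. Qed.

Lemma box_openW x : box_open a x -> box_closed a x.
Proof. by move=> bx i; have /andP[/ltW -> /ltW ->] := bx i. Qed.

Lemma box_closed_compact : compact (@box_closed R d a).
Proof.
have -> : @box_closed R d a =
    [set v | forall i, (fun _ : 'I_d => `[(- a), a]%classic) i (v ord0 i)].
  by apply/seteqP; split=> x /= bx i; have := bx i; rewrite in_itv.
by apply: (@rV_compact R d (fun=> `[(- a), a]%classic)) => i; exact: segment_compact.
Qed.

(** Heine's theorem: compactness of the box makes the modulus uniform. This form passes easily to
    integrals over a coordinate and to restrictions to a face. *)
Lemma box_continuousP f : {within box_closed a, continuous f} <->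
  (forall e, 0 < e -> exists2 r, 0 < r & forall x y,
     box_closed a x -> box_closed a y ->
     (forall i, `|x 0 i - y 0 i| < r) -> `|f x - f y| <= e).
Proof.
split=> [/subspace_continuousP cf e e0|H]; last first.
  apply/subspace_continuousP => x bx; apply/cvgrPdist_le => e /H[r r0 Hr].
  rewrite near_withinE; apply/nbhs_ballP; exists r => //= y [_ xy] By.
  by apply: Hr => // i; exact: xy.
pose P (r : R) x := box_closed a x -> forall y, box_closed a y ->
  (forall i, `|x 0 i - y 0 i| < r) -> `|f x - f y| <= e.
have : \forall r \near 0^'+, box_closed a `<=` P r.
  have /compact_near_coveringP cov := box_closed_compact.
  apply: cov => x bx.
  have /cvgrPdist_le/(_ (e / 2)) := cf _ bx.
  rewrite divr_gt0// => /(_ isT); rewrite near_withinE.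
  move=> /nbhs_ballP[r /= r0 Hr].
  (* Half the radius leaves room for two moves, from [x] to [x'] and from [x'] to [y]. *)
  exists (ball x (r / 2), [set t | 0 < t < r / 2]) => /=.
    split; first by apply: nbhsx_ballx; rewrite divr_gt0.
    by near=> t; apply/andP; split; near: t;
      [exact: nbhs_right_gt|apply: nbhs_right_lt; rewrite divr_gt0].
  move=> [x' t]/= [[_ xx'] /andP[t0 tr]] bx' y By x'y.
  have h1 : `|f x - f x'| <= e / 2.
    apply: Hr => //; split=> // i j; apply: lt_trans (xx' i j) _.
    by rewrite ltr_pdivrMr// mulr_natr mulr2n ltrDl.
  have h2 : `|f x - f y| <= e / 2.
    apply: Hr => //; split=> // i j; rewrite (ord1 i) /ball/=.
    have := xx' 0 j; rewrite /ball/= => h3; have := x'y j => h4.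
    have := ler_distD (x' 0 j) (x 0 j) (y 0 j); lra.
  have := ler_distD (f x) (f x') (f y); rewrite distrC in h1; lra.
move=> HP; near (0 : R)^'+ => r.
exists r => [|x y bx By xy]; first by near: r; exact: nbhs_right_gt.
suff : box_closed a `<=` P r by move=> H; exact: H.
by near: r.
Unshelve. all: by end_near. Qed.

Lemma slice_continuous f (k : nat) x :
  {within box_closed a, continuous f} -> box_closed a x ->
  {within `[- a, a], continuous (fun t => f (setcoord x k t))}.
Proof.
move=> /box_continuousP cf bx; apply/subspace_continuousP => t ta.
apply/cvgrPdist_le => e /cf[r r0 Hr].
rewrite near_withinE; apply/nbhs_ballP; exists r => //= s st sa.
apply: Hr; [exact: setcoord_closed|exact: setcoord_closed|] => i.
by rewrite !mxE; case: ifP => // _; rewrite subrr normr0.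
Qed.

Lemma slice_integrable f (k : nat) x :
  {within box_closed a, continuous f} -> box_closed a x ->
  (@lebesgue_measure R).-integrable `]- a, a[
    (EFin \o (fun t => f (setcoord x k t))).
Proof.
move=> cf bx.
apply: continuous_integrable_oo; exact: slice_continuous.
Qed.

(** [iter_int a f k.+1] unfolds to [coord_int a (iter_int a f k) k], so facts about a single
    integration pass to [iter_int] by induction. *)
Definition coord_int f (k : nat) x : R :=
  \int[lebesgue_measure]_(t in `]- a, a[) f (setcoord x k t).

Hypothesis a0 : 0 < a.

Lemma coord_int_cst (c : R) : \int[lebesgue_measure]_(t in `]- a, a[) c = 2 * a * c.
Proof.
rewrite Rintegral_cst//= lebesgue_measure_itv/= lte_fin gtrN// -EFinB/= mulrC; lra.
Qed.

Lemma coord_int_le f g (k : nat) x :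
  {within box_closed a, continuous f} -> {within box_closed a, continuous g} ->
  box_closed a x ->
  (forall t, - a < t < a -> f (setcoord x k t) <= g (setcoord x k t)) ->
  coord_int f k x <= coord_int g k x.
Proof.
move=> cf cg bx fg; have ig := slice_integrable k cg bx.
by apply: le_Rintegral (slice_integrable k cf bx) ig _.
Qed.

Lemma int_norm_le (h : R -> R) e :
  (@lebesgue_measure R).-integrable `]- a, a[ (EFin \o h) ->
  (forall t, - a < t < a -> `|h t| <= e) ->
  `|\int[lebesgue_measure]_(t in `]- a, a[) h t| <= 2 * a * e.
Proof.
move=> ih he.
have ic (c : R) :
    (@lebesgue_measure R).-integrable `]- a, a[ (EFin \o cst c).
  apply: continuous_integrable_oo.
  by apply: continuous_subspaceT => x; exact: cvg_cst.
have {}he t : `]- a, a[%classic t -> - e <= h t <= e.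
  by rewrite /= in_itv -ler_norml; exact: he.
rewrite ler_norml -mulrN -!coord_int_cst; apply/andP; split.
  by apply: le_Rintegral (ic _) ih _ => // t /he /andP[].
by apply: le_Rintegral ih (ic _) _ => // t /he /andP[].
Qed.

Lemma coord_int_dist f (k : nat) x y e :
  {within box_closed a, continuous f} -> box_closed a x -> box_closed a y ->
  (forall t, - a < t < a -> `|f (setcoord x k t) - f (setcoord y k t)| <= e) ->
  `|coord_int f k x - coord_int f k y| <= 2 * a * e.
Proof.
move=> cf bx By fe; rewrite /coord_int -RintegralB//; last 2 first.
- exact: slice_integrable.
- exact: slice_integrable.
apply: int_norm_le => //.
exact: (integrableB _ (slice_integrable k cf bx) (slice_integrable k cf By)).
Qed.

Lemma coord_int_continuous f (k : nat) :
  {within box_closed a, continuous f} ->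
  {within box_closed a, continuous (coord_int f k)}.
Proof.
move=> cf; apply/box_continuousP => e e0.
have /box_continuousP/(_ (e / (2 * a)))[|r r0 Hr] := cf.
  by rewrite divr_gt0 ?mulr_gt0.
exists r => // x y bx By xy.
have -> : e = 2 * a * (e / (2 * a)) by field; rewrite gt_eqF.
apply: coord_int_dist => // t /andP[/ltW ta /ltW at_].
apply: Hr; [apply: setcoord_closed => //; exact/andP..|] => i.
by rewrite !mxE; case: ifP => // _; rewrite subrr normr0.
Qed.

Lemma iter_int_continuous f (k : nat) :
  {within box_closed a, continuous f} ->
  {within box_closed a, continuous (iter_int a f k)}.
Proof. by move=> cf; elim: k => [//|k]; exact: coord_int_continuous. Qed.

Lemma iter_int_le f g (k : nat) x :
  {within box_closed a, continuous f} -> {within box_closed a, continuous g} ->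
  (forall x, box_open a x -> f x <= g x) -> box_open a x ->
  iter_int a f k x <= iter_int a g k x.
Proof.
move=> cf cg fg; elim: k x => [//|k IH] x bx.
apply: coord_int_le; [exact: iter_int_continuous..|exact: box_openW|].
by move=> t ta; apply/IH/setcoord_open.
Qed.

Lemma iter_int_eq f g (k : nat) x :
  (forall x, box_open a x -> f x = g x) -> box_open a x ->
  iter_int a f k x = iter_int a g k x.
Proof.
move=> fg; elim: k x => [//|k IH] x bx /=.
apply: eq_Rintegral => t; rewrite inE /= in_itv => ta.
exact/IH/setcoord_open.
Qed.

Lemma iter_int_ge0 f (k : nat) x :
  (forall x, box_open a x -> 0 <= f x) -> box_open a x -> 0 <= iter_int a f k x.
Proof.
move=> f0; elim: k x => [//|k IH] x bx.
apply: Rintegral_ge0 => t; rewrite /= in_itv => ta.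
exact/IH/setcoord_open.
Qed.

Lemma iter_intD f g (k : nat) x :
  {within box_closed a, continuous f} -> {within box_closed a, continuous g} ->
  box_open a x ->
  iter_int a (fun x => f x + g x) k x = iter_int a f k x + iter_int a g k x.
Proof.
move=> cf cg; elim: k x => [//|k IH] x bx /=.
rewrite -RintegralD//; last 2 first.
- by apply: slice_integrable; [exact: iter_int_continuous|exact: box_openW].
- by apply: slice_integrable; [exact: iter_int_continuous|exact: box_openW].
apply: eq_Rintegral => t; rewrite inE /= in_itv => ta.
exact/IH/setcoord_open.
Qed.

Lemma iter_intZ f (c : R) (k : nat) x :
  {within box_closed a, continuous f} -> box_open a x ->
  iter_int a (fun x => c * f x) k x = c * iter_int a f k x.
Proof.
move=> cf; elim: k x => [//|k IH] x bx /=.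
rewrite -RintegralZl//; last first.
  by apply: slice_integrable; [exact: iter_int_continuous|exact: box_openW].
apply: eq_Rintegral => t; rewrite inE /= in_itv => ta.
exact/IH/setcoord_open.
Qed.

(** The first [k] integrations overwrite only coordinates below [k], hence commute with freezing
    coordinate [i]. This turns face values of a partial integral into partial integrals of face
    values. *)
Lemma iter_int_setcoord f i (c : R) (k : nat) x : (k <= i)%N ->
  iter_int a f k (setcoord x i c) =
  iter_int a (fun y => f (setcoord y i c)) k x.
Proof.
elim: k x => [//|k IH] x ki /=; apply: eq_Rintegral => t _.
pose k' := Ordinal (ltn_trans ki (ltn_ord i)).
rewrite -IH; last exact: ltnW.
rewrite (@setcoordC x i k')// -val_eqE /= gtn_eqF//.
Qed.
End Box.

(** * Integration by parts *)

Section Derivatives.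
Context {R : realType} {d : nat} (a : R).
Hypothesis a0 : 0 < a.
Implicit Types (x y : 'rV[R]_d) (i j : 'I_d) (f g F G u p q : 'rV[R]_d -> R).

Definition slice_derive i F G := forall x, box_open a x ->
  is_derive (x 0 i) 1 (fun t => F (setcoord x i t)) (G x).

(* The bound being uniform in [x], this notion is preserved by integration over
   the other coordinates; this takes the place of Fubini's theorem. *)
Definition unif_derive i F G := forall e, 0 < e -> exists2 r, 0 < r &
  forall x t, box_open a x -> - a < t < a -> `|t - x 0 i| < r ->
  `|F (setcoord x i t) - F x - (t - x 0 i) * G x| <= e * `|t - x 0 i|.

Lemma slice_deriveE i F G x s : slice_derive i F G -> box_open a x ->
  - a < s < a ->
  is_derive s 1 (fun t => F (setcoord x i t)) (G (setcoord x i s)).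
Proof.
move=> dF bx sa; have := dF _ (setcoord_open i bx sa).
rewrite setcoord_same; under eq_fun do rewrite setcoordK.
exact.
Qed.

(** The conclusion does not depend on the order of [s] and [t] and allows [s = t], so later
    increments may have either sign. *)
Lemma MVT_oo (h dh : R -> R) s t :
  (forall c, - a < c < a -> is_derive c 1 h (dh c)) ->
  - a < s < a -> - a < t < a ->
  exists c, [/\ - a < c < a, `|c - s| <= `|t - s| & h t - h s = dh c * (t - s)].
Proof.
move=> hd sa ta; have [st|/ltW ts] := lerP s t; last first.
  have [||c' c'I E] := @MVT_segment R h dh t s ts.
  - move=> z; rewrite in_itv/= => z1; apply: hd; lra.
  - apply: derivable_within_continuous => z; rewrite in_itv/= => z1.
    by have [] : is_derive z 1 h (dh z) by apply: hd; lra.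
  exists c'; move: c'I; rewrite in_itv/= => c'I; split; first by lra.
    by rewrite !ler0_norm; lra.
  by rewrite -opprB E; ring.
have [||c cI E] := @MVT_segment R h dh s t st.
- move=> z; rewrite in_itv/= => z1; apply: hd; lra.
- apply: derivable_within_continuous => z; rewrite in_itv/= => z1.
  by have [] : is_derive z 1 h (dh z) by apply: hd; lra.
exists c; move: cI; rewrite in_itv/= => cI; split => //; first by lra.
by rewrite !ger0_norm; lra.
Qed.

Lemma slice_MVT i F G x s t : slice_derive i F G -> box_open a x ->
  - a < s < a -> - a < t < a ->
  exists c, [/\ - a < c < a, `|c - s| <= `|t - s| &
    F (setcoord x i t) - F (setcoord x i s) = G (setcoord x i c) * (t - s)].
Proof.
move=> dF bx.
apply: (@MVT_oo (fun t => F (setcoord x i t))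
  (fun c => G (setcoord x i c))) => c ca.
exact: slice_deriveE.
Qed.

(** The mean value theorem gives the increment through [G] at an intermediate point; uniform
    continuity of [G] then yields one radius for all base points. *)
Lemma unif_derive_slice i F G : {within box_closed a, continuous G} ->
  slice_derive i F G -> unif_derive i F G.
Proof.
move=> /box_continuousP cG dF e e0; have [r r0 Hr] := cG _ e0.
exists r => // x t bx ta tr.
have [c [ca ct E]] := slice_MVT dF bx (bx i) ta.
rewrite setcoord_id in E; rewrite E mulrC -mulrBr normrM mulrC.
apply: ler_wpM2r => //; apply: Hr.
- exact/box_openW/setcoord_open.
- exact/box_openW.
- move=> j; rewrite setcoordE; case: eqP => [->|_]; last by rewrite subrr normr0.
  exact: le_lt_trans tr.
Qed.

Lemma is_derive_unif i F G x : unif_derive i F G -> box_open a x ->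
  is_derive (x 0 i) 1 (fun t => F (setcoord x i t)) (G x).
Proof.
move=> dF bx; set f := fun t => _.
have H : (fun h : R => h^-1 *: (f (h *: 1 + x 0 i) - f (x 0 i))) @ 0^' --> G x.
  apply/cvgrPdist_le => e /dF[r r0 Hr]; have /andP[x1 x2] := bx i.
  near=> h; have h0 : h != 0 by near: h; exact: nbhs_dnbhs_neq.
  (* [unif_derive] speaks of interior points only, so the radius must also keep [h + x 0 i] inside
     the open interval. *)
  have hr : `|h| < Num.min r (Num.min (a - x 0 i) (x 0 i + a)).
    near: h; apply: dnbhs0_lt; rewrite !lt_min r0; lra.
  move: hr; rewrite !lt_min => /andP[hr /andP[h1 h2]].
  have hx : - a < h + x 0 i < a by move: h1 h2; rewrite !ltr_norml; lra.
  have := Hr x (h + x 0 i) bx hx; rewrite addrK => /(_ hr) H.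
  rewrite /f [h%:A]mulr1 setcoord_id distrC -(ler_pM2l (_ : 0 < `|h|)) ?normr_gt0//.
  rewrite -normrM mulrBr [h * (_ *: _)]mulVKf // [`|h| * e]mulrC.
  exact: H.
split; first exact: (cvgP _ H).
exact: (cvg_lim _ H).
Unshelve. all: by end_near. Qed.

(** The error is at most [e / (2 * a)] times the increment, uniformly in the integrated coordinate,
    which ranges over an interval of length [2 * a]. *)
Lemma unif_derive_coord_int i F G (k : nat) : k != i ->
  {within box_closed a, continuous F} -> {within box_closed a, continuous G} ->
  unif_derive i F G -> unif_derive i (coord_int a F k) (coord_int a G k).
Proof.
move=> ki cF cG dF e e0; have [|r r0 Hr] := dF (e / (2 * a)).
  by rewrite divr_gt0 ?mulr_gt0.
exists r => // x t bx ta tr.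
have cx := box_openW bx; have cxt := box_openW (setcoord_open i bx ta).
have I1 := slice_integrable k cF cx.
have I2 := slice_integrable k cF cxt.
have I3 := slice_integrable k cG cx.
rewrite /coord_int -RintegralZl// -RintegralB// -RintegralB//; last 2 first.
- exact: (integrableB _ I2 I1).
- exact: (integrableZl _ _ I3).
have -> : e * `|t - x 0 i| = 2 * a * (e / (2 * a) * `|t - x 0 i|).
  by field; rewrite gt_eqF.
apply: int_norm_le => //.
  exact: (integrableB _ (integrableB _ I2 I1) (integrableZl _ _ I3)).
move=> s sa; have := Hr (setcoord x k s) t (setcoord_open _ bx sa) ta.
rewrite mxE eq_sym (negbTE ki) => /(_ tr).
congr (`| F _ - _ - _ | <= _); apply/rowP => j; rewrite !mxE.
by have [->|] := eqVneq (j : nat) k; rewrite ?(negbTE ki).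
Qed.

Lemma unif_derive_iter i F G (k : nat) : (k <= i)%N ->
  {within box_closed a, continuous F} -> {within box_closed a, continuous G} ->
  unif_derive i F G -> unif_derive i (iter_int a F k) (iter_int a G k).
Proof.
move=> + cF cG dF; elim: k => [//|k IH] ki.
apply: unif_derive_coord_int; first by rewrite ltn_eqF.
- exact: iter_int_continuous.
- exact: iter_int_continuous.
- by apply: IH; exact: ltnW.
Qed.

Lemma coord_int_FTC i F G x :
  {within box_closed a, continuous F} -> {within box_closed a, continuous G} ->
  unif_derive i F G -> box_open a x ->
  coord_int a G i x = F (setcoord x i a) - F (setcoord x i (- a)).
Proof.
move=> cF cG dF bx; have cx := box_openW bx.
have aa : - a < a by rewrite gtrN.
pose h t := F (setcoord x i t).
have dh t : - a < t < a -> is_derive t 1 h (G (setcoord x i t)).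
  move=> ta; have := is_derive_unif dF (setcoord_open i bx ta).
  rewrite setcoord_same; under eq_fun do rewrite setcoordK.
  exact.
have ch := @slice_continuous _ _ a _ i x cF cx.
have [_ h1 h2] := (continuous_within_itvP h aa).1 ch.
have dh' : derivable_oo_LRcontinuous h (- a) a.
  by split => // t; rewrite in_itv/= => /dh[].
have := continuous_FTC2 aa (@slice_continuous _ _ a _ i x cG cx) dh'.
move=> FTC; have sG := @slice_continuous _ _ a _ i x cG cx.
have iG := continuous_compact_integrable (@segment_compact R (- a) a) sG.
rewrite /coord_int Rintegral_itv_bndo_bndc; last exact: slice_integrable.
rewrite Rintegral_itv_obnd_cbnd; last first.
  apply: integrableS iG => //; exact: subset_itv_oc_cc.
rewrite /Rintegral FTC//= => t; rewrite in_itv/= => /dh dt.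
by rewrite derive1E; apply: derive_val.
Qed.

Lemma face_continuous F i (c : R) : - a <= c <= a ->
  {within box_closed a, continuous F} ->
  {within box_closed a, continuous (fun x => F (setcoord x i c))}.
Proof.
move=> ca /box_continuousP cF; apply/box_continuousP => e /cF[r r0 Hr].
exists r => // x y bx By xy; apply: Hr; [exact: setcoord_closed..|] => j.
by rewrite !mxE; case: ifP => // _; rewrite subrr normr0.
Qed.

(** The coordinates below [i] are integrated first, and differentiability in [x_i] survives. The
    integral over [x_i] is then a difference of face integrals, nonnegative by hypothesis, and the
    remaining integrations preserve the sign. *)
Lemma cube_int_divergence_ge0 i F G :
  {within box_closed a, continuous F} -> {within box_closed a, continuous G} ->
  slice_derive i F G ->
  (forall x, box_open a x -> F (setcoord x i (- a)) <= F (setcoord x i a)) ->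
  0 <= cube_int a G.
Proof.
move=> cF cG dF Fa.
have dF' := unif_derive_slice cG dF.
have aa : - a <= a by rewrite ltW// gtrN.
have b0 : box_open a (0 : 'rV[R]_d) by move=> j; rewrite mxE a0 oppr_lt0 a0.
have step x : box_open a x -> 0 <= iter_int a G i.+1 x.
  move=> bx /=; rewrite -[X in 0 <= X]/(coord_int a (iter_int a G i) i x).
  have ii : (i <= i)%N by [].
  have cF' : {within box_closed a, continuous (iter_int a F i)}.
    exact: iter_int_continuous.
  have cG' : {within box_closed a, continuous (iter_int a G i)}.
    exact: iter_int_continuous.
  rewrite (coord_int_FTC cF' cG' (unif_derive_iter ii cF cG dF') bx).
  rewrite !iter_int_setcoord// subr_ge0; apply: iter_int_le => //.
  - by apply: face_continuous => //; rewrite lexx aa.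
  - by apply: face_continuous => //; rewrite lexx aa.
(* [k] counts the coordinates above [i], still to be integrated. *)
have [k dk] : exists k, d = (k + i.+1)%N.
  by exists (d - i.+1)%N; rewrite subnK.
rewrite /cube_int; move: b0.
suff H x : box_open a x -> 0 <= iter_int a G (k + i.+1) x.
  by move=> /H; rewrite -dk.
elim: k x {dk} => [|k IH] x bx; first exact: step.
rewrite addSn; apply: Rintegral_ge0 => t; rewrite /= in_itv => ta.
exact/IH/setcoord_open.
Qed.

(** [G] is tied to [F] only inside the box, so [F] cannot be differentiated along the face itself.
    On a parallel slice close enough to the face, [F] is small compared with a fixed increment in
    [x_i]; hence so are its difference quotient and [G], and continuity of [G] carries the bound to
    the face. *)
Lemma derive_zero_on_face i j F G (c : R) x : i != j -> `|c| = a ->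
  {within box_closed a, continuous F} -> {within box_closed a, continuous G} ->
  unif_derive i F G ->
  (forall x, box_closed a x -> x 0 j = c -> F x = 0) ->
  box_open a x -> G (setcoord x j c) = 0.
Proof.
move=> ij ca cF cG dF F0 bx; set y := setcoord x j c.
have ca' : - a <= c <= a by rewrite -ler_norml ca.
have cy : box_closed a y by apply: setcoord_closed => //; exact: box_openW.
apply/eqP; rewrite -normr_le0; apply/ler_addgt0Pl => e4; rewrite addr0.
(* One [e] for each of two values of [F], one for the error of the difference quotient, one for the
   change of [G] between slice and face. *)
rewrite -[e4](@divfK _ 4)//; move: (e4 / 4) => e.
rewrite pmulr_lgt0// => e0.
have [r r0 Hr] := dF _ e0.
have [x1 x2] : - a < x 0 i /\ x 0 i < a by have /andP[] := bx i.
(* A fraction of the distance to [a]: [t] stays inside and, as [a - x 0 i < 2 * a], within [r] of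
   [x 0 i]. *)
pose t := x 0 i + (a - x 0 i) * (r / (r + 2 * a)).
have ra0 : 0 < r + 2 * a by rewrite addr_gt0// mulr_gt0.
have tE : t - x 0 i = (a - x 0 i) * (r / (r + 2 * a)) by rewrite /t; ring.
have t0 : 0 < t - x 0 i by rewrite tE mulr_gt0 ?subr_gt0// divr_gt0.
have tr : `|t - x 0 i| < r.
  rewrite gtr0_norm// tE mulrA ltr_pdivrMr// mulrC ltr_pM2l//; lra.
have ta : - a < t < a.
  have : (a - x 0 i) * (r / (r + 2 * a)) < a - x 0 i.
    by rewrite gtr_pMr ?subr_gt0// ltr_pdivrMr// mul1r ltrDl mulr_gt0.
  rewrite -tE; lra.
(* The slice is chosen after the increment, so that [F] on it is at most [e] times that
   increment. *)
have /box_continuousP/(_ (e * `|t - x 0 i|))[|r1 r10 H1] := cF.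
  by rewrite mulr_gt0// normr_gt0 gt_eqF.
have /box_continuousP/(_ _ e0)[r2 r20 H2] := cG.
pose q := Num.min r1 r2; have q0 : 0 < q by rewrite lt_min r10.
(* [c] pulled towards [0], whatever its sign: [|s - c| = a q / (q + 2 a) < q]. *)
pose s := c * (2 * a / (q + 2 * a)).
have qa0 : 0 < q + 2 * a by rewrite addr_gt0// mulr_gt0.
have sa : - a < s < a.
  rewrite -ltr_norml normrM ca gtr_pMr// ger0_norm ?divr_ge0 ?mulr_ge0 ?ltW//.
  by rewrite ltr_pdivrMr// mul1r ltrDr.
have sq : `|s - c| < q.
  have -> : s - c = - c * (q / (q + 2 * a)) by rewrite /s; field; rewrite gt_eqF.
  rewrite normrM normrN ca ger0_norm ?divr_ge0 ?(ltW q0) ?(ltW qa0)//.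
  rewrite mulrA ltr_pdivrMr// mulrC ltr_pM2l//; lra.
have [sr1 sr2] : `|s - c| < r1 /\ `|s - c| < r2.
  by move: sq; rewrite lt_min => /andP[].
pose x' := setcoord x j s.
have bx' : box_open a x' by exact: setcoord_open.
have x'i : x' 0 i = x 0 i by rewrite setcoordE (negbTE ij).
have := Hr x' t bx' ta; rewrite x'i => /(_ tr) K.
have near_face z : box_closed a z -> `|F (setcoord z j s)| <= e * `|t - x 0 i|.
  move=> cz; rewrite -[F _]subr0 -(F0 (setcoord z j c)) ?setcoord_same//.
    apply: H1; [apply: setcoord_closed => //; lra|exact: setcoord_closed|] => l.
    by rewrite !setcoordE; case: eqP => // _; rewrite subrr normr0.
  exact: setcoord_closed.
have K1 := near_face _ (box_openW bx).
have K2 := near_face _ (box_openW (setcoord_open i bx ta)).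
rewrite setcoordC// -/x' in K2.
have K3 : `|G x' - G y| <= e.
  apply: H2 => //; first exact: box_openW.
  by move=> l; rewrite !setcoordE; case: eqP => // _; rewrite subrr normr0.
have K4 : `|t - x 0 i| * `|G x'| <= `|t - x 0 i| * (3 * e).
  rewrite -normrM; move: K K1 K2; rewrite !ler_norml -/x'.
  set A := F _; set B := F _; set D := _ * G x'; set M := `|_|; lra.
rewrite ler_pM2l ?normr_gt0 ?gt_eqF// in K4.
have := ler_distD (G x') 0 (G y); rewrite !sub0r !normrN => ?; lra.
Qed.

(** * Symmetry of the mixed second derivatives *)

Lemma second_difference i j u p q x e : i != j -> box_open a x -> 0 < e ->
  {within box_closed a, continuous q} ->
  slice_derive i u p -> slice_derive j p q ->
  exists2 r, 0 < r & forall h, 0 < h < r ->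
  `|u (setcoord (setcoord x i (x 0 i + h)) j (x 0 j + h))
    - u (setcoord x i (x 0 i + h)) - u (setcoord x j (x 0 j + h)) + u x
    - h ^+ 2 * q x| <= e * h ^+ 2.
Proof.
move=> ij bx e0 /box_continuousP/(_ _ e0)[r r0 Hr] du dp.
have /andP[xi1 xi2] := bx i; have /andP[xj1 xj2] := bx j.
exists (Num.min r (Num.min (a - x 0 i) (a - x 0 j))).
  by rewrite !lt_min r0 !subr_gt0 xi2 xj2.
move=> h; rewrite !lt_min => /andP[h0 /and3P[hr hi hj]].
have hia : - a < x 0 i + h < a by lra.
have hja : - a < x 0 j + h < a by lra.
pose y := setcoord x j (x 0 j + h).
have By : box_open a y by exact: setcoord_open.
(* The mean value theorem in [x_i] for [psi], then in [x_j] for [p], makes the second difference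
   equal to [h ^+ 2] times [q] at a point near [x]. *)
pose psi s := u (setcoord y i s) - u (setcoord x i s).
have dpsi s : - a < s < a ->
    is_derive s 1 psi (p (setcoord y i s) - p (setcoord x i s)).
  move=> sa; have d1 := slice_deriveE du By sa; have d2 := slice_deriveE du bx sa.
  exact: is_deriveB.
have [c [ca ch E]] := MVT_oo dpsi (bx i) hia.
have [c' [ca' ch' E']] := slice_MVT dp (setcoord_open i bx ca) (bx j) hja.
have yx : setcoord y i c = setcoord (setcoord x i c) j (x 0 j + h).
  by rewrite setcoordC// eq_sym.
have xx : setcoord (setcoord x i c) j (x 0 j) = setcoord x i c.
  by rewrite setcoordC// setcoord_id.
rewrite xx -yx in E'; rewrite E' in E.
have -> : setcoord (setcoord x i (x 0 i + h)) j (x 0 j + h) = setcoord y i (x 0 i + h).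
  by rewrite setcoordC.
have y0 : setcoord y i (x 0 i) = y.
  by rewrite -[RHS](setcoord_id y i); congr setcoord; rewrite setcoordE (negbTE ij).
move: E; rewrite /psi setcoord_id y0 -/y => E.
set z := setcoord _ j c' in E.
have -> : u (setcoord y i (x 0 i + h)) - u (setcoord x i (x 0 i + h)) - u y + u x
    - h ^+ 2 * q x = (q z - q x) * h ^+ 2.
  transitivity (u (setcoord y i (x 0 i + h)) - u (setcoord x i (x 0 i + h)) -
    (u y - u x) - h ^+ 2 * q x); first by ring.
  by rewrite E; ring.
rewrite normrM [`|h ^+ 2|]ger0_norm ?sqr_ge0//; apply: ler_wpM2r; first exact: sqr_ge0.
have chh : `|c - x 0 i| < r by apply: le_lt_trans ch _; rewrite addrC addKr gtr0_norm.
have chh' : `|c' - x 0 j| < r by apply: le_lt_trans ch' _; rewrite addrC addKr gtr0_norm.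
apply: Hr => [||l].
- by apply/box_openW/setcoord_open => //; exact: setcoord_open.
- exact: box_openW.
- rewrite /z !setcoordE; case: eqP => [->//|_]; case: eqP => [->//|_].
  by rewrite subrr normr0.
Qed.

(** Exchanging [i] and [j] does not change the second difference, so [h ^+ 2 * q x] and
    [h ^+ 2 * q' x] approximate the same number. *)
Lemma mixed_derivatives i j u p q p' q' x :
  {within box_closed a, continuous q} -> {within box_closed a, continuous q'} ->
  slice_derive i u p -> slice_derive j p q ->
  slice_derive j u p' -> slice_derive i p' q' ->
  i != j -> box_open a x -> q x = q' x.
Proof.
move=> cq cq' dip djq djp' diq' ij bx.
apply/eqP; rewrite -subr_eq0 -normr_le0; apply/ler_addgt0Pl => e2; rewrite addr0.
rewrite -[e2](@divfK _ 2)//; move: (e2 / 2) => e.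
rewrite pmulr_lgt0// => e0.
have [r r0 H] := second_difference ij bx e0 cq dip djq.
have ji : j != i by rewrite eq_sym.
have [r' r0' H'] := second_difference ji bx e0 cq' djp' diq'.
pose h := Num.min r r' / 2.
have m0 : 0 < Num.min r r' by rewrite lt_min r0.
have h0 : 0 < h by rewrite divr_gt0.
have [hr hr'] : h < r /\ h < r'.
  by apply/andP; rewrite -lt_min /h ltr_pdivrMr// mulr_natr mulr2n ltrDl.
have := H h; have := H' h; rewrite h0 hr hr' => /(_ isT) K' /(_ isT) K.
rewrite [in X in `|X|]setcoordC// in K'.
have h2 : 0 < h ^+ 2 by rewrite exprn_gt0.
rewrite -(ler_pM2l h2) -[X in X * `|_|]gtr0_norm// -normrM.
move: K K'; rewrite !ler_norml.
set A := u _; set B := u _; set D := u _; set X := u x.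
set P := e * _; have -> : h ^+ 2 * (e * 2) = 2 * P by rewrite /P; ring.
rewrite mulrBr; set U := _ * q x; set V := _ * q' x.
lra.
Qed.

End Derivatives.

(** * The estimate for a general weight *)

Section C1.
Context {R : realType} {d : nat} (a : R).
Implicit Types (x y : 'rV[R]_d) (i j : 'I_d) (f g F G u p q : 'rV[R]_d -> R).

(** [G] is carried as data because on the boundary [partial] depends on values outside the box;
    there the continuous extensions take its place. The rules below then compute the derivative of a
    flux by unification. *)
Definition C1_along i F G := [/\ {within box_closed a, continuous F},
  {within box_closed a, continuous G} & slice_derive a i F G].

Lemma box_continuousD f g :
  {within box_closed a, continuous f} -> {within box_closed a, continuous g} ->
  {within box_closed a, continuous (fun x => f x + g x)}.
Proof. by move=> cf cg x; apply: cvgD; [exact: cf|exact: cg]. Qed.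

Lemma box_continuousM f g :
  {within box_closed a, continuous f} -> {within box_closed a, continuous g} ->
  {within box_closed a, continuous (fun x => f x * g x)}.
Proof. by move=> cf cg x; apply: cvgM; [exact: cf|exact: cg]. Qed.

Lemma box_continuous_cst (c : R) :
  {within box_closed a, continuous (fun _ : 'rV[R]_d => c)}.
Proof. by move=> x; exact: cvg_cst. Qed.

Lemma box_continuousX f (k : nat) : {within box_closed a, continuous f} ->
  {within box_closed a, continuous (fun x => f x ^+ k)}.
Proof.
move=> cf; elim: k => [|k IH]; first exact: box_continuous_cst.
by under eq_fun do rewrite exprS; exact: box_continuousM.
Qed.

Lemma box_continuous_sum (I : Type) (s : seq I) (P : pred I) (f : I -> 'rV[R]_d -> R) :
  (forall k, P k -> {within box_closed a, continuous (f k)}) ->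
  {within box_closed a, continuous (fun x => \sum_(k <- s | P k) f k x)}.
Proof.
move=> cf; elim: s => [|k s IH].
  by under eq_fun do rewrite big_nil; exact: box_continuous_cst.
under eq_fun do rewrite big_cons; have := cf k; case: (P k) => // /(_ isT) cfk.
exact: box_continuousD.
Qed.

Lemma C1_alongD i f g df dg : C1_along i f df -> C1_along i g dg ->
  C1_along i (fun x => f x + g x) (fun x => df x + dg x).
Proof.
move=> [cf cdf sf] [cg cdg sg]; split; [exact: box_continuousD..|].
move=> x bx; have h1 := sf x bx; have h2 := sg x bx.
exact: is_deriveD.
Qed.

Lemma C1_alongM i f g df dg : C1_along i f df -> C1_along i g dg ->
  C1_along i (fun x => f x * g x) (fun x => df x * g x + f x * dg x).
Proof.
move=> [cf cdf sf] [cg cdg sg]; split; first exact: box_continuousM.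
  by apply: box_continuousD; exact: box_continuousM.
move=> x bx; have h1 := sf x bx; have h2 := sg x bx.
have := is_deriveM h1 h2; rewrite setcoord_id => h.
apply: is_derive_eq h _.
by rewrite /GRing.scale/= addrC [df x * _]mulrC.
Qed.

Lemma C1_along_cst i (c : R) : C1_along i (fun=> c) (fun=> 0).
Proof.
by split; [exact: box_continuous_cst..|move=> x bx; exact: is_derive_cst].
Qed.

Lemma slice_derive_partial i F G f :
  (forall x, box_open a x -> F x = f x) ->
  (forall x, box_open a x -> G x = partial i f x) ->
  (forall x, box_open a x -> derivable f x (unitv i)) -> slice_derive a i F G.
Proof.
move=> Ff Gf df x bx; rewrite Gf//.
have E : (fun h : R => h^-1 *: ((f \o shift x) (h *: unitv i) - f x)) =
  (fun h : R => h^-1 *: (((fun t => f (setcoord x i t)) \o shift (x 0 i)) (h *: 1)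
     - f (setcoord x i (x 0 i)))).
  apply/funext => h /=; rewrite setcoord_id; congr (_ *: (f _ - _)).
  apply/rowP => j; rewrite setcoordE /unitv !mxE eqxx/= [h%:A]mulr1.
  by case: eqP => [->|_]; rewrite ?mulr1// mulr0 add0r.
have H : is_derive (x 0 i) 1 (fun t => f (setcoord x i t)) (partial i f x).
  have := df x bx; rewrite /partial /derive /derivable E => H; exact: DeriveDef.
(* [F] and [f] agree only inside the box, which suffices near an interior point. *)
apply: near_eq_is_derive H.
have /andP[x1 x2] := bx i.
near=> t; rewrite Ff//; apply: setcoord_open => //; apply/andP; split; near: t.
  exact: lt_nbhsr.
exact: lt_nbhsl.
Unshelve. all: by end_near. Qed.

Hypothesis a0 : 0 < a.

Lemma box_open0 : box_open a (0 : 'rV[R]_d).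
Proof. by move=> j; rewrite mxE a0 oppr_lt0 a0. Qed.

Lemma cube_int_eq f g : (forall x, box_open a x -> f x = g x) ->
  cube_int a f = cube_int a g.
Proof. by move=> fg; apply: iter_int_eq => //; exact: box_open0. Qed.

Lemma cube_int_ge0 f : (forall x, box_open a x -> 0 <= f x) -> 0 <= cube_int a f.
Proof. by move=> f0; apply: iter_int_ge0 => //; exact: box_open0. Qed.

Lemma cube_int_le f g :
  {within box_closed a, continuous f} -> {within box_closed a, continuous g} ->
  (forall x, box_open a x -> f x <= g x) -> cube_int a f <= cube_int a g.
Proof. by move=> cf cg fg; apply: iter_int_le => //; exact: box_open0. Qed.

Lemma cube_intD f g :
  {within box_closed a, continuous f} -> {within box_closed a, continuous g} ->
  cube_int a (fun x => f x + g x) = cube_int a f + cube_int a g.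
Proof. by move=> cf cg; apply: iter_intD => //; exact: box_open0. Qed.

Lemma cube_intZ f (c : R) : {within box_closed a, continuous f} ->
  cube_int a (fun x => c * f x) = c * cube_int a f.
Proof. by move=> cf; apply: iter_intZ => //; exact: box_open0. Qed.

Lemma cube_int_sum_ge0 (I : Type) (s : seq I) (P : pred I) (f : I -> 'rV[R]_d -> R) :
  (forall k, P k -> {within box_closed a, continuous (f k)}) ->
  (forall k, P k -> 0 <= cube_int a (f k)) ->
  0 <= cube_int a (fun x => \sum_(k <- s | P k) f k x).
Proof.
move=> cf f0; elim: s => [|k s IH].
  by apply: cube_int_ge0 => x _; rewrite big_nil.
under eq_fun do rewrite big_cons.
have := cf k; have := f0 k; case: (P k) => // /(_ isT) fk0 /(_ isT) cfk.
by rewrite cube_intD ?addr_ge0//; exact: box_continuous_sum.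
Qed.

End C1.

(** * Fluxes and the pointwise identity *)

Section General.
Context {R : realType} {n : nat} (a : R).
Hypothesis a0 : 0 < a.
Local Notation V := 'rV[R]_n.+1.
Local Notation m := (@ord_max n).
Implicit Types (x y : V) (i j : 'I_n.+1) (f g F G u p q : V -> R).

(** The factor [(i == m)%:R] handles all directions at once. The second derivative [ddk] provides
    the continuity of [dk]. *)
Lemma zcoord_C1 i (k dk ddk : R -> R) :
  (forall t, - a <= t <= a -> is_derive t 1 k (dk t)) ->
  (forall t, - a <= t <= a -> is_derive t 1 dk (ddk t)) ->
  C1_along a i (fun x : V => k (zcoord x))
    (fun x : V => (i == m)%:R * dk (zcoord x)).
Proof.
have cz (h dh : R -> R) : (forall t, - a <= t <= a -> is_derive t 1 h (dh t)) ->
    {within box_closed a, continuous (fun x : V => h (zcoord x))}.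
  move=> hd; apply/subspace_continuousP => x bx.
  apply: cvg_within_filter.
  have dh' := hd _ (bx m).
  have ch : {for zcoord x, continuous h}.
    by apply: differentiable_continuous; apply/derivable1_diffP; case: dh'.
  apply: (@continuous_comp _ _ _ (@zcoord R n) h x) => //.
  exact: coord_continuous.
move=> hk hdk; split; first exact: cz hk.
  by apply: box_continuousM; [exact: box_continuous_cst|exact: cz hdk].
move=> x bx; have [->|im] := eqVneq i m.
  rewrite mul1r; have := hk _ (box_openW bx m).
  by rewrite /zcoord; under [X in _ -> is_derive _ _ X _]eq_fun do rewrite setcoord_same.
rewrite mul0r /zcoord; under eq_fun do rewrite setcoordE eq_sym (negbTE im).
exact: is_derive_cst.
Qed.

(** Lets [ring] replace the raw output [G] of the product rule by a chosen expression [H]. *)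
Lemma cube_int_C1_ge0 i F G H : C1_along a i F G -> (forall x, G x = H x) ->
  (forall x, box_open a x -> F (setcoord x i (- a)) <= F (setcoord x i a)) ->
  {within box_closed a, continuous H} /\ 0 <= cube_int a H.
Proof.
move=> [cF cG dF] /funext <- Fa; split => //.
exact: cube_int_divergence_ge0 cF cG dF Fa.
Qed.

(* [S], [S2], [S3], [S4] are the successive derivatives of the exponent [s] of
   the weight [exp s], and [E = exp (2 s)]. *)
Variables (E S S2 S3 S4 : V -> R).
Hypothesis E_C1 : forall i, C1_along a i E (fun x => (i == m)%:R * (2 * S x * E x)).
Hypothesis S_C1 : forall i, C1_along a i S (fun x => (i == m)%:R * S2 x).
Hypothesis S2_C1 : forall i, C1_along a i S2 (fun x => (i == m)%:R * S3 x).
Hypothesis S3_C1 : forall i, C1_along a i S3 (fun x => (i == m)%:R * S4 x).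
Hypothesis E_ge0 : forall x, box_closed a x -> 0 <= E x.
Hypothesis S_ge0 : forall x, box_closed a x -> 0 <= S x.
Hypothesis S2_ge0 : forall x, box_closed a x -> 0 <= S2 x.
(** The right side is half the coefficient of [u^2] obtained from 2 P1 P2. The target consumes
    [3 / 2 * S^2 S2]: [1 / 2] directly, and [1] through [p m = v - S u], as
    [1 / 2 * (v - S u)^2 <= v^2 + S^2 u^2]. *)
Hypothesis S_large : forall x, box_open a x ->
  3 / 4 * (S x ^+ 2 * S2 x) <= S x ^+ 2 * S2 x + S x * S3 x - S2 x ^+ 2 - S4 x.

Variables (u : V -> R) (p : 'I_n.+1 -> V -> R) (q : 'I_n.+1 -> 'I_n.+1 -> V -> R).
Hypothesis u_C1 : forall i, C1_along a i u (p i).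
Hypothesis p_C1 : forall i j, C1_along a j (p i) (q i j).
Hypothesis u_face : forall x i, box_closed a x -> `|x 0 i| = a -> u x = 0.
Hypothesis p_top : forall x, box_closed a x -> zcoord x = a -> p m x = 0.

Let p_face i j (c : R) x : i != j -> `|c| = a -> box_open a x ->
  p i (setcoord x j c) = 0.
Proof.
move=> ij ca bx; have [cu cp du] := u_C1 i.
refine (derive_zero_on_face a0 ij ca cu cp (unif_derive_slice cp du) _ bx).
by move=> y cy yc; apply: (@u_face y j) => //; rewrite yc.
Qed.

Let uf j (c : R) x : `|c| = a -> box_open a x -> u (setcoord x j c) = 0.
Proof.
move=> ca bx; apply: (@u_face _ j); last by rewrite setcoord_same.
by apply: setcoord_closed; [exact: box_openW|rewrite -ler_norml ca].
Qed.

(* With [w = exp s * u]: [v = exp (- s) * w_z], and [- 2 * W] is [exp (- s)]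
   times the part [P2 = - 2 * s' * w_z - 2 * s'' * w] of the conjugated
   Laplacian. *)
Let v x := p m x + S x * u x.
Let W x := S x * v x + S2 x * u x.

Let Na : `|- a| = a. Proof. by rewrite normrN gtr0_norm. Qed.
Let Pa : `|a| = a. Proof. by rewrite gtr0_norm. Qed.

(** Derivative in [x_i] of the flux [- 2 * E * p i * W], which comes from pairing the second
    derivative in [x_i] with P2. *)
Let side i x := - 2 * E x * (q i i x * W x +
  p i x * (S x * (q m i x + S x * p i x) + S2 x * p i x)).

(** On the faces normal to [x_i], both [u] and its tangential derivative [p m] vanish, hence so does
    [W]. *)
Let side_flux i : i != m ->
  {within box_closed a, continuous (side i)} /\ 0 <= cube_int a (side i).
Proof.
move=> im; have := E_C1 i; have := S_C1 i; have := S2_C1 i.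
rewrite (negbTE im) => C2 CS CE.
have CF := C1_alongM (C1_alongM (C1_along_cst a i (- 2)) CE) (C1_alongM (p_C1 i i)
  (C1_alongD (C1_alongM CS (C1_alongD (p_C1 m i) (C1_alongM CS (u_C1 i))))
     (C1_alongM C2 (u_C1 i)))).
apply: (cube_int_C1_ge0 CF) => [x|x bx]; first by rewrite /side /W /v/=; ring.
have mi : m != i by rewrite eq_sym.
by rewrite !uf// !(p_face mi)//; lra.
Qed.

(** The z-derivative of [E * S * p i ^+ 2], which absorbs the mixed term left by [side]; this flux
    vanishes at both ends, where [p i] is tangential. *)
Let tang i x := E x * (2 * S x ^+ 2 * p i x ^+ 2 +
  S2 x * p i x ^+ 2 + 2 * S x * p i x * q i m x).

Let tangential_flux i : i != m ->
  {within box_closed a, continuous (tang i)} /\ 0 <= cube_int a (tang i).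
Proof.
move=> im; have := E_C1 m; have := S_C1 m; rewrite eqxx => CS CE.
have CF := C1_alongM (C1_alongM CE CS) (C1_alongM (p_C1 i m) (p_C1 i m)).
apply: (cube_int_C1_ge0 CF) => [x|x bx]; first by rewrite /tang/=; ring.
by rewrite !(p_face im)// !mul0r !mulr0.
Qed.

Let dv x := q m m x + S2 x * u x + S x * p m x.
(** The z-derivative of [E * (- S v^2 - 2 S2 u v + S3 u^2 - (S^3 + S S2) u^2)]. In terms of w, the
    summands come from [w_zz w_z], from [w_zz w], from the [w w_z] that the latter leaves, and from
    the zeroth-order part of P1 against [w_z]. *)
Let vertical x := E x * (2 * S x * (- (S x * v x ^+ 2) - 2 * S2 x * u x * v x +
      S3 x * u x ^+ 2 - (S x ^+ 3 + S x * S2 x) * u x ^+ 2)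
    - S2 x * v x ^+ 2 - 2 * S x * v x * dv x - 2 * S3 x * u x * v x
    - 2 * S2 x * p m x * v x - 2 * S2 x * u x * dv x + S4 x * u x ^+ 2
    + 2 * S3 x * u x * p m x
    - (3 * S x ^+ 2 * S2 x + S2 x ^+ 2 + S x * S3 x) * u x ^+ 2
    - 2 * (S x ^+ 3 + S x * S2 x) * u x * p m x).

(** With [u = 0] at both ends only [- E S (p m)^2] is left: zero on top by [p_top], nonpositive at
    the bottom. *)
Let vertical_flux :
  {within box_closed a, continuous vertical} /\ 0 <= cube_int a vertical.
Proof.
have := E_C1 m; have := S_C1 m; have := S2_C1 m; have := S3_C1 m.
rewrite eqxx => C3 C2 CS CE.
have Cv := C1_alongD (p_C1 m m) (C1_alongM CS (u_C1 m)).
have Cu2 := C1_alongM (u_C1 m) (u_C1 m).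
have CF := C1_alongM CE (C1_alongD (C1_alongD (C1_alongD
  (C1_alongM (C1_along_cst a m (- 1)) (C1_alongM CS (C1_alongM Cv Cv)))
  (C1_alongM (C1_along_cst a m (- 2)) (C1_alongM C2 (C1_alongM (u_C1 m) Cv))))
  (C1_alongM C3 Cu2))
  (C1_alongM (C1_along_cst a m (- 1)) (C1_alongM
    (C1_alongD (C1_alongM CS (C1_alongM CS CS)) (C1_alongM CS C2)) Cu2))).
apply: (cube_int_C1_ge0 CF) => [x|x bx].
  by rewrite /vertical /dv /v/=; ring.
have aa : - a <= a by rewrite ltW// gtrN.
have ca : box_closed a (setcoord x m a).
  by apply: setcoord_closed; [exact: box_openW|rewrite lexx aa].
have cNa : box_closed a (setcoord x m (- a)).
  by apply: setcoord_closed; [exact: box_openW|rewrite lexx aa].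
rewrite !uf// (p_top ca); last by rewrite /zcoord setcoord_same.
rewrite !(mulr0, mul0r, addr0) mulN1r mulrN oppr_le0.
by rewrite mulr_ge0 ?E_ge0// mulr_ge0 ?S_ge0// -expr2 sqr_ge0.
Qed.

Let q_sym i x : i != m -> box_open a x -> q i m x = q m i x.
Proof.
move=> im bx; have [_ c1 d1] := p_C1 i m; have [_ c2 d2] := p_C1 m i.
have [_ _ d3] := u_C1 i; have [_ _ d4] := u_C1 m.
exact: (mixed_derivatives c1 c2 d3 d1 d4 d2 im bx).
Qed.

(** Pointwise, the right integrand exceeds the left one by [2 * N] plus a nonnegative remainder,
    where [N] sums all the flux derivatives and so has a nonnegative integral. *)
Lemma carleman_weight :
  cube_int a (fun x => 2^-1 * (E x * (S2 x *
     (S x ^+ 2 * u x ^+ 2 + \sum_i p i x ^+ 2)))) <=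
  cube_int a (fun x => E x * (\sum_i q i i x) ^+ 2).
Proof.
have cE : {within box_closed a, continuous E} by case: (E_C1 m).
have cS : {within box_closed a, continuous S} by case: (S_C1 m).
have cS2 : {within box_closed a, continuous S2} by case: (S2_C1 m).
have cu : {within box_closed a, continuous u} by case: (u_C1 m).
have cp i : {within box_closed a, continuous (p i)} by case: (u_C1 i).
have cq i j : {within box_closed a, continuous (q i j)} by case: (p_C1 i j).
have cst i : i != m ->
    {within box_closed a, continuous (fun x => side i x + tang i x)}.
  move=> im; have [c1 _] := side_flux im; have [c2 _] := tangential_flux im.
  exact: box_continuousD.
have [cvert vert0] := vertical_flux.
pose N x := \sum_(i | i != m) (side i x + tang i x) + vertical x.
pose L x := 2^-1 * (E x * (S2 x * (S x ^+ 2 * u x ^+ 2 + \sum_i p i x ^+ 2))).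
have csum : {within box_closed a,
    continuous (fun x => \sum_(i | i != m) (side i x + tang i x))}.
  exact: box_continuous_sum.
have cN : {within box_closed a, continuous N} by exact: box_continuousD.
have cL : {within box_closed a, continuous L}.
  have cp2 : {within box_closed a, continuous (fun x => \sum_i p i x ^+ 2)}.
    by apply: box_continuous_sum => i _; exact: box_continuousX.
  exact (box_continuousM (@box_continuous_cst R n.+1 a 2^-1) (box_continuousM cE
    (box_continuousM cS2 (box_continuousD (box_continuousM
      (@box_continuousX R n.+1 a _ 2 cS) (@box_continuousX R n.+1 a _ 2 cu)) cp2)))).
have c2N := box_continuousM (@box_continuous_cst R n.+1 a 2) cN.
have cD : {within box_closed a, continuous (fun x => \sum_i q i i x)}.
  exact: box_continuous_sum.
have N0 : 0 <= cube_int a N.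
  rewrite cube_intD// addr_ge0//; apply: cube_int_sum_ge0 => // i im.
  have [c1 s0] := side_flux im; have [c2 t0] := tangential_flux im.
  by rewrite cube_intD// addr_ge0.
have : cube_int a (fun x => 2 * N x + L x) <=
    cube_int a (fun x => E x * (\sum_i q i i x) ^+ 2).
  apply: cube_int_le => //.
  - exact: box_continuousD.
  - exact: (box_continuousM cE (@box_continuousX R n.+1 a _ 2 cD)).
  move=> x bx; rewrite -subr_ge0.
  (* By [q_sym] the mixed terms of [side] and [tang] cancel. *)
  have -> : N x = - 2 * E x * W x * (\sum_(i | i != m) q i i x)
      - E x * S2 x * (\sum_(i | i != m) p i x ^+ 2) + vertical x.
    rewrite /N; congr (_ + _); rewrite !mulr_sumr -sumrB; apply: eq_bigr => i im.
    by rewrite /side /tang q_sym//; ring.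
  have -> : \sum_i q i i x = q m m x + \sum_(i | i != m) q i i x.
    by rewrite (bigD1 m).
  rewrite /L.
  have -> : \sum_i p i x ^+ 2 = p m x ^+ 2 + \sum_(i | i != m) p i x ^+ 2.
    by rewrite (bigD1 m).
  have G0 : 0 <= \sum_(i | i != m) p i x ^+ 2.
    by apply: sumr_ge0 => i _; exact: sqr_ge0.
  move: G0; set G := \sum_(i | i != m) p i x ^+ 2.
  set Q := \sum_(i | i != m) q i i x => G0.
  (* The terms are P1^2, P2^2, the margin in [S_large], and what remains of the gradient terms once
     [p m x] is written as [v x - S x * u x]. *)
  rewrite [X in 0 <= X](_ : _ = E x * ((q m m x + Q + 2 * W x) ^+ 2 + 4 * W x ^+ 2 +
    2 * (S x ^+ 2 * S2 x + S x * S3 x - S2 x ^+ 2 - S4 x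
         - 3 / 4 * (S x ^+ 2 * S2 x)) * u x ^+ 2 +
    S2 x * (3 / 2 * G + 5 * v x ^+ 2 + 1 / 2 * (v x + S x * u x) ^+ 2))).
    have E0 := E_ge0 (box_openW bx); have S20 := S2_ge0 (box_openW bx).
    have K0 := S_large bx; rewrite -subr_ge0 in K0.
    apply: mulr_ge0 => //; apply: addr_ge0; last first.
      by apply: mulr_ge0 => //; rewrite !addr_ge0// mulr_ge0 ?sqr_ge0.
    apply: addr_ge0; last by rewrite mulr_ge0 ?sqr_ge0// mulr_ge0.
    by apply: addr_ge0; [exact: sqr_ge0|apply: mulr_ge0 => //; exact: sqr_ge0].
  rewrite /vertical /W /dv /v; by field.
move=> H; apply: le_trans H.
have hD := cube_intD a0 c2N cL; have hZ := cube_intZ a0 2 cN.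
by rewrite hD hZ; apply: ler_wpDl => //; exact: mulr_ge0.
Qed.

End General.

(** * The power weight *)

(** The new coefficient and exponent enter through equations, so that the lemma fits [S], [S2] and
    the others as they are written. *)
Lemma is_derive_shift_powR (R : realType) (r c s c' s' t : R) : 0 < t + r ->
  c' = c * s -> s' = s - 1 ->
  is_derive t 1 (fun t => c * (t + r) `^ s) (c' * (t + r) `^ s').
Proof.
move=> tr -> ->.
have d1 : is_derive t 1 (fun t : R => t + r) 1.
  by apply: is_derive_eq; rewrite addr0.
have d2 := is_derive1_powR s tr.
have d3 := @is_derive1_comp R (fun x : R => x `^ s) (fun t : R => t + r) t _ _ d2 d1.
have := is_deriveZ c d3 => h; apply: is_derive_eq h _.
by rewrite /GRing.scale/= mulr1 mulrA.
Qed.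

Section Weight.
Context {R : realType} {n : nat} (a r b beta lam : R).
Hypotheses (a0 : 0 < a) (ar : a + 1 < r) (br : a + r < b) (b1 : 1 < beta).
Local Notation V := 'rV[R]_n.+1.
Local Notation m := (@ord_max n).
Let cb := b `^ (- beta).
Let c1 := lam * cb * beta.
Let c2 := c1 * (beta - 1).
Let c3 := c2 * (beta - 2).
Let c4 := c3 * (beta - 3).
Let E t := expR (2 * (lam * cb * (t + r) `^ beta)).
Let S t := c1 * (t + r) `^ (beta - 1).
Let S2 t := c2 * (t + r) `^ (beta - 2).
Let S3 t := c3 * (t + r) `^ (beta - 3).
Let S4 t := c4 * (t + r) `^ (beta - 4).
(** Provides the derivative of [S4] from which [zcoord_C1] gets its continuity. *)
Let S5 t := c4 * (beta - 4) * (t + r) `^ (beta - 5).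

Let shift_gt1 t : - a <= t <= a -> 1 < t + r.
Proof. by have := ar => ? ?; lra. Qed.

Let shift_gt0 t : - a <= t <= a -> 0 < t + r.
Proof. by move=> /shift_gt1; exact: lt_trans. Qed.

Let dE t : - a <= t <= a -> is_derive t 1 E (2 * S t * E t).
Proof.
move=> ta; pose h t := 2 * (lam * cb) * (t + r) `^ beta.
have -> : E = expR \o h by apply/funext => s; rewrite /E /h/= mulrA.
have dh : is_derive t 1 h (2 * S t).
  rewrite /S mulrA; apply: is_derive_shift_powR => //; first exact: shift_gt0.
  by rewrite /c1; ring.
have de := is_derive_expR (h t).
have := @is_derive1_comp R expR h t _ _ de dh => H.
by apply: is_derive_eq H _; rewrite mulrC.
Qed.

Let dS t : - a <= t <= a -> is_derive t 1 S (S2 t).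
Proof.
move=> ta; apply: is_derive_shift_powR => //; first exact: shift_gt0.
ring.
Qed.
Let dS2 t : - a <= t <= a -> is_derive t 1 S2 (S3 t).
Proof.
move=> ta; apply: is_derive_shift_powR => //; first exact: shift_gt0.
ring.
Qed.
Let dS3 t : - a <= t <= a -> is_derive t 1 S3 (S4 t).
Proof.
move=> ta; apply: is_derive_shift_powR => //; first exact: shift_gt0.
ring.
Qed.
Let dS4 t : - a <= t <= a -> is_derive t 1 S4 (S5 t).
Proof.
move=> ta; apply: is_derive_shift_powR => //; first exact: shift_gt0.
ring.
Qed.

Let ddE t : - a <= t <= a ->
  is_derive t 1 (fun t => 2 * S t * E t) (2 * S2 t * E t + 2 * S t * (2 * S t * E t)).
Proof.
move=> ta; have h1 := dE ta.
have h2 : is_derive t 1 (fun t => 2 * S t) (2 * S2 t) := is_deriveZ 2 (dS ta).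
have := is_deriveM h2 h1 => H; apply: is_derive_eq H _.
by rewrite /GRing.scale/=; ring.
Qed.

Let pow_split (k : nat) t : - a <= t <= a ->
  (t + r) `^ (beta - k%:R) = (t + r) `^ beta * (t + r)^-1 ^+ k.
Proof.
move=> ta; have t0 := shift_gt0 ta.
rewrite powRB; last by rewrite (gt_eqF t0) implybT.
by rewrite powR_mulrn ?ltW// exprVn.
Qed.

Let kappa := (beta - 2) * (beta - 3).
Hypothesis lam_large : (8 + kappa ^+ 2) / (cb * beta) < lam.

Let b_gt0 : 0 < b. Proof. by have := (ar, br, a0) => -[[? ?] ?]; lra. Qed.
Let cb0 : 0 < cb. Proof. exact: powR_gt0. Qed.
Let cbb : 0 < cb * beta. Proof. by rewrite mulr_gt0// (lt_trans _ b1). Qed.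
Let lam0 : 0 < lam.
Proof.
apply: le_lt_trans lam_large.
by apply: divr_ge0; [rewrite addr_ge0 ?sqr_ge0|exact: ltW].
Qed.

Let pow_ge1 t : - a <= t <= a -> 1 <= (t + r) `^ beta.
Proof.
move=> ta; have <- : 1 `^ beta = 1 :> R by rewrite powR1.
apply: ge0_ler_powR; rewrite ?nnegrE//.
- by rewrite ltW// (lt_trans _ b1).
- exact/ltW/shift_gt0.
- exact/ltW/shift_gt1.
Qed.

Let c1_large : 8 + kappa ^+ 2 <= c1.
Proof. by move: lam_large; rewrite ltr_pdivrMr// /c1 mulrA => /ltW. Qed.

(** With [P = (t + r)^beta], [T = (t + r)^-1] and [X = c1 * P], the lower-order terms sum to
    [- (beta - 1) T^4 (X^2 + kappa X)], against a slack of [(beta - 1) T^4 X^3 / 4]. As [P >= 1],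
    [X >= 8 + kappa^2] for every [t], which suffices. *)
Let S_large t : - a <= t <= a ->
  3 / 4 * (S t ^+ 2 * S2 t) <= S t ^+ 2 * S2 t + S t * S3 t - S2 t ^+ 2 - S4 t.
Proof.
move=> ta; rewrite /S /S2 /S3 /S4 (pow_split 1 ta) (pow_split 2 ta).
rewrite (pow_split 3 ta) (pow_split 4 ta) -subr_ge0.
have P1 := pow_ge1 ta; have c1K := c1_large.
have T0 : 0 < (t + r)^-1 by rewrite invr_gt0 shift_gt0.
move: P1 T0; set P := _ `^ _; set T := _^-1 => P1 T0.
have c10 : 0 < c1 by apply: lt_le_trans c1_large; rewrite ltr_pwDl// sqr_ge0.
have XK : 8 + kappa ^+ 2 <= c1 * P.
  by apply: le_trans c1K _; rewrite ler_peMr// ltW.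
rewrite [X in 0 <= X](_ : _ = (beta - 1) * T ^+ 4 * (c1 * P) *
    ((c1 * P) * (c1 * P - 8) / 4 + (c1 * P - kappa))); last first.
  by rewrite /c4 /c3 /c2 /kappa; field.
move: XK; set X := c1 * P => XK.
have k0 : 0 <= kappa ^+ 2 by exact: sqr_ge0.
have k1 : 0 <= (kappa - 1) ^+ 2 by exact: sqr_ge0.
have X8 : 0 <= X - 8 by lra.
have X0 : 0 <= X by lra.
have Xk : 0 <= X - kappa by move: k1 XK; rewrite sqrrB1 mulr2n; lra.
apply: mulr_ge0; last by apply: addr_ge0 => //; rewrite divr_ge0// mulr_ge0.
rewrite mulr_ge0// mulr_ge0 ?subr_ge0 ?(ltW b1)//.
by rewrite exprn_ge0// ltW.
Qed.

Lemma cweightE (x : V) : box_closed a x -> cweight lam beta r b x = E (zcoord x).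
Proof.
move=> bx; have z0 := shift_gt0 (bx m); rewrite /cweight /E; congr expR.
rewrite powRM ?invr_ge0 ?(ltW b_gt0) ?(ltW z0)// /cb powRN.
have -> : b^-1 `^ beta = (b `^ beta)^-1.
  by rewrite -powR_inv1 ?(ltW b_gt0)// -powRrM mulN1r powRN.
by rewrite -!mulrA [X in lam * X]mulrC.
Qed.

Lemma carleman_powR (u : V -> R) (A B : R) :
  C2_closure a u -> (forall x, box_boundary a x -> u x = 0) ->
  dz_zero_on_top a u ->
  (forall t, - a <= t <= a -> A <= 2^-1 * (S2 t * S t ^+ 2)) ->
  (forall t, - a <= t <= a -> B <= 2^-1 * S2 t) ->
  A * cube_int a (fun x => cweight lam beta r b x * u x ^+ 2) +
  B * cube_int a (fun x => cweight lam beta r b x * grad_norm2 u x) <=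
  cube_int a (fun x => cweight lam beta r b x * laplacian u x ^+ 2).
Proof.
move=> [cu du dp dq] ub [g [gu gtop]] HA HB.
(* For the last coordinate the extension taken must be the one that [dz_zero_on_top] provides. *)
have /choice[p Hp] : forall i, exists p, cont_ext a (partial i u) p /\
    (i = m -> forall x, Gamma_plus a x -> p x = 0).
  move=> i; have [->|im] := eqVneq i m; first by exists g; split.
  by have [h hu] := dp i; exists h; split => // E'; rewrite E' eqxx in im.
have /choice[q Hq] : forall ij : 'I_n.+1 * 'I_n.+1,
    exists q, cont_ext a (partial ij.2 (partial ij.1 u)) q.
  by move=> [i j]; exact: dq.
have u_C1 i : C1_along a i u (p i).
  have [[cp pu] _] := Hp i; split => //.
  apply: (@slice_derive_partial _ _ _ _ _ _ u) => // x bx.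
  by have [] := du x bx i i.
have p_C1 i j : C1_along a j (p i) (q (i, j)).
  have [[cp pu] _] := Hp i; have [cq qu] := Hq (i, j); split => //.
  apply: (@slice_derive_partial _ _ _ _ _ _ (partial i u)) => // x bx.
  by have [] := du x bx i j.
have u_face (x : V) i : box_closed a x -> `|x 0 i| = a -> u x = 0.
  move=> cx xi; apply: ub; split=> // /(_ i).
  by rewrite -ltr_norml xi ltxx; exact/negP.
have p_top (x : V) : box_closed a x -> zcoord x = a -> p m x = 0.
  by move=> cx xa; have [_ ->] := Hp m.
have c1_ge0 : 0 < c1 by apply: lt_le_trans c1_large; rewrite ltr_pwDl// sqr_ge0.
have S_ge0 (x : V) : box_closed a x -> 0 <= S (zcoord x).
  by move=> _; rewrite mulr_ge0 ?powR_ge0// ltW.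
have S2_ge0 (x : V) : box_closed a x -> 0 <= S2 (zcoord x).
  move=> _; rewrite mulr_ge0 ?powR_ge0// /c2 mulr_ge0 ?subr_ge0 ?(ltW b1)//.
  exact: ltW.
have E_ge0 (x : V) : box_closed a x -> 0 <= E (zcoord x) by rewrite expR_ge0.
have main := carleman_weight a0 (fun i => zcoord_C1 i dE ddE)
  (fun i => zcoord_C1 i dS dS2) (fun i => zcoord_C1 i dS2 dS3)
  (fun i => zcoord_C1 i dS3 dS4) E_ge0 S_ge0 S2_ge0
  (fun x bx => S_large (box_openW bx m)) u_C1 p_C1 u_face p_top.
have cE : {within box_closed a, continuous (fun x : V => E (zcoord x))}.
  by have [] := zcoord_C1 m dE ddE.
have cS : {within box_closed a, continuous (fun x : V => S (zcoord x))}.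
  by have [] := zcoord_C1 m dS dS2.
have cS2 : {within box_closed a, continuous (fun x : V => S2 (zcoord x))}.
  by have [] := zcoord_C1 m dS2 dS3.
have cp2 : {within box_closed a, continuous (fun x => \sum_i p i x ^+ 2)}.
  by apply: box_continuous_sum => i _; apply: box_continuousX; case: (u_C1 i).
have cu2 := @box_continuousX _ _ a u 2 cu.
have cEu := box_continuousM cE cu2.
have cEp := box_continuousM cE cp2.
rewrite (@cube_int_eq _ _ a a0 _ (fun x => E (zcoord x) * u x ^+ 2)); last first.
  by move=> x /box_openW bx; rewrite cweightE.
rewrite (@cube_int_eq _ _ a a0 (fun x => _ * grad_norm2 u x)
    (fun x => E (zcoord x) * \sum_i p i x ^+ 2)); last first.
  move=> x bx; rewrite cweightE; last exact: box_openW.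
  by congr (_ * _); apply: eq_bigr => i _; have [[_ ->]] := Hp i.
rewrite (@cube_int_eq _ _ a a0 (fun x => _ * laplacian u x ^+ 2)
    (fun x => E (zcoord x) * (\sum_i q (i, i) x) ^+ 2)); last first.
  move=> x bx; rewrite cweightE; last exact: box_openW.
  by congr (_ * _ ^+ 2); apply: eq_bigr => i _; have [_ ->] := Hq (i, i).
apply: le_trans main.
rewrite -(cube_intZ a0 A cEu) -(cube_intZ a0 B cEp).
have cA := box_continuousM (@box_continuous_cst R n.+1 a A) cEu.
have cB := box_continuousM (@box_continuous_cst R n.+1 a B) cEp.
rewrite -(cube_intD a0 cA cB).
apply: (cube_int_le a0 (box_continuousD cA cB)).
  exact (box_continuousM (@box_continuous_cst R n.+1 a 2^-1) (box_continuousM cE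
    (box_continuousM cS2 (box_continuousD (box_continuousM
      (@box_continuousX R n.+1 a _ 2 cS) cu2) cp2)))).
move=> x bx; have zx := box_openW bx m.
have G0 : 0 <= \sum_i p i x ^+ 2 by apply: sumr_ge0 => i _; exact: sqr_ge0.
have := HA _ zx; have := HB _ zx; rewrite -![x 0 m]/(zcoord x).
set G := \sum_i _; set e := E _; set s := S _; set s2 := S2 _ => hB hA.
have e0 : 0 <= e by exact/E_ge0/box_openW.
have -> : 2^-1 * (e * (s2 * (s ^+ 2 * u x ^+ 2 + G))) =
  2^-1 * (s2 * s ^+ 2) * (e * u x ^+ 2) + 2^-1 * s2 * (e * G) by ring.
by apply: lerD; apply: ler_wpM2r => //; rewrite mulr_ge0// sqr_ge0.
Qed.

(** [b^-1 ^+ 4] bounds from below the factor [(t + r)^-1 ^+ 4] of [S2 * S ^+ 2], as [t + r < b];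
    [2^-1] comes from [carleman_weight]. *)
Let Cst := 2^-1 * b^-1 ^+ 4.

Lemma coef_grad t : - a <= t <= a ->
  Cst * lam * (beta - 1) * b `^ (- beta) <= 2^-1 * S2 t.
Proof.
move=> ta; rewrite /S2 (pow_split 2 ta).
have P1 := pow_ge1 ta.
have T0 : 0 < (t + r)^-1 by rewrite invr_gt0 shift_gt0.
have bT : b^-1 <= (t + r)^-1.
  rewrite lef_pV2 ?posrE ?shift_gt0//; have := br => ?; lra.
have b1' : b^-1 <= 1.
  rewrite invf_le1//; have := (a0, ar, br) => -[[? ?] ?]; lra.
have bi0 : 0 < b^-1 by rewrite invr_gt0.
move: P1 T0 bT; set P := _ `^ beta; set T := (t + r)^-1 => P1 T0 bT.
rewrite /Cst /c2 /c1 -/cb.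
have -> : 2^-1 * (lam * cb * beta * (beta - 1) * (P * T ^+ 2)) =
  (2^-1 * lam * (beta - 1) * cb) * ((beta * P) * T ^+ 2) by ring.
have -> : 2^-1 * b^-1 ^+ 4 * lam * (beta - 1) * cb =
  (2^-1 * lam * (beta - 1) * cb) * b^-1 ^+ 4 by ring.
apply: ler_wpM2l; first by rewrite !mulr_ge0 ?subr_ge0// ltW.
(* [S2] carries only [T ^+ 2]; since [b > 1], the constant shared with the other coefficient is
   still small enough. *)
apply: (@le_trans _ _ (b^-1 ^+ 2)).
  rewrite -[leRHS]mulr1 (exprD _ 2 2); apply: ler_wpM2l; first exact: sqr_ge0.
  by apply: exprn_ile1 => //; exact: ltW.
apply: (@le_trans _ _ (T ^+ 2)); first by apply: lerXn2r => //; rewrite nnegrE ltW.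
by rewrite ler_peMl ?sqr_ge0// mulr_ege1// ltW.
Qed.

Lemma coef_u t : - a <= t <= a ->
  Cst * lam ^+ 3 * beta ^+ 2 * (beta - 1) * b `^ (- (3 * beta))
    * (r - a) `^ (2 * beta) <= 2^-1 * (S2 t * S t ^+ 2).
Proof.
move=> ta; rewrite /S2 /S (pow_split 2 ta) (pow_split 1 ta).
have P1 := pow_ge1 ta.
have T0 : 0 < (t + r)^-1 by rewrite invr_gt0 shift_gt0.
have bT : b^-1 <= (t + r)^-1.
  rewrite lef_pV2 ?posrE ?shift_gt0//; have := br => ?; lra.
have bi0 : 0 < b^-1 by rewrite invr_gt0.
have beta0 : 0 <= beta by rewrite ltW// (lt_trans _ b1).
have -> : b `^ (- (3 * beta)) = cb ^+ 3.
  rewrite /cb -powR_mulrn ?powR_ge0// -powRrM; congr (_ `^ _); ring.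
have -> : (r - a) `^ (2 * beta) = ((r - a) `^ beta) ^+ 2.
  rewrite -powR_mulrn ?powR_ge0// -powRrM; congr (_ `^ _); ring.
have wP : (r - a) `^ beta <= (t + r) `^ beta.
  have := (a0, ar) => -[a_gt0 r_gt].
  by apply: ge0_ler_powR => //; rewrite ?nnegrE; lra.
have w0 : 0 <= (r - a) `^ beta by exact: powR_ge0.
move: P1 T0 bT wP w0; set P := (t + r) `^ beta; set T := (t + r)^-1.
set w := _ `^ beta => P1 T0 bT wP w0.
rewrite /Cst /c2 /c1.
set D := 2^-1 * lam ^+ 3 * (beta - 1) * cb ^+ 3 * beta ^+ 2.
rewrite [leLHS](_ : _ = D * (w ^+ 2 * b^-1 ^+ 4)); last by rewrite /D; ring.
rewrite [leRHS](_ : _ = D * ((P ^+ 2 * T ^+ 4) * (beta * P))); last by rewrite /D; ring.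
apply: ler_wpM2l.
  by rewrite /D !mulr_ge0 ?exprn_ge0 ?subr_ge0// ltW.
apply: (@le_trans _ _ (P ^+ 2 * T ^+ 4)).
  apply: ler_pM; rewrite ?exprn_ge0 ?(ltW bi0)//.
    by apply: lerXn2r => //; rewrite nnegrE (le_trans w0).
  by apply: lerXn2r => //; rewrite nnegrE ltW.
apply: ler_peMr; last by rewrite mulr_ege1// ltW.
by rewrite mulr_ge0 ?exprn_ge0 ?(ltW T0)// (le_trans w0).
Qed.

End Weight.

Theorem theorem3p1 (R : realType) (n : nat) (a r b : R) :
  0 < a -> a + 1 < r -> a + r < b ->
  exists C : R, 0 < C /\
  forall beta : R, 1 < beta ->
  exists lam0 : R, forall lam : R, lam0 < lam ->
  forall u : 'rV[R]_n.+1 -> R,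
    C2_closure a u ->
    (forall x, box_boundary a x -> u x = 0) ->
    dz_zero_on_top a u ->
    cube_int a (fun x => cweight lam beta r b x * (laplacian u x) ^+ 2) >=
      C * lam ^+ 3 * beta ^+ 2 * (beta - 1) * b `^ (- (3 * beta))
        * (r - a) `^ (2 * beta)
        * cube_int a (fun x => cweight lam beta r b x * (u x) ^+ 2)
      + C * lam * (beta - 1) * b `^ (- beta)
        * cube_int a (fun x => cweight lam beta r b x * grad_norm2 u x).
Proof.
move=> a0 ar br; have b0 : 0 < b by lra.
exists (2^-1 * b^-1 ^+ 4); split; first by rewrite mulr_gt0// exprn_gt0// invr_gt0.
move=> beta b1.
exists ((8 + ((beta - 2) * (beta - 3)) ^+ 2) / (b `^ (- beta) * beta)) => lam hlam.
move=> u Cu ub uz.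
apply: (carleman_powR a0 ar br b1 hlam Cu ub uz) => t ta.
  exact: (coef_u a0 ar br b1 hlam ta).
exact: (coef_grad a0 ar br b1 hlam ta).
Qed.
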